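(* Suppose IV relevance holds: for every $a\in\mathcal{A}$ and $l\in\mathcal{L}$, $Z$ and $I\{A=a\}$ are not conditionally independent given $L=l$, i.e. there exist two distinct values $z_0,z_1\in\mathcal{Z}$ with $\Pr(A=a\mid Z=z_0,L=l)\ne\Pr(A=a\mid Z=z_1,L=l)$. Let $a\in\mathcal{A}$ and $A^{(a)}:=I\{A=a\}$. If there is a function $f_a^o(A^{(a)},L)$ solving $$\mathbb{E}[A^{(a)}Y\mid Z,L]=\mathbb{E}[f_a^o(A^{(a)},L)\mid Z,L],$$ then it is unique. Moreover, for any regular weighting function $\pi(Z,L)$ for $A=a$, the solution satisfies $$f_a^o(0,L)=-\frac{\mathrm{Cov}\{A^{(a)}Y,\pi(Z,L)\mid L\}}{\mathrm{Cov}\{A^{(a)},\pi(Z,L)\mid L\}}\,\mathbb{E}[A^{(a)}\mid Z,L]+\mathbb{E}[A^{(a)}Y\mid Z,L],$$ $$f_a^o(1,L)=\frac{\mathrm{Cov}\{A^{(a)}Y,\pi(Z,L)\mid L\}}{\mathrm{Cov}\{A^{(a)},\pi(Z,L)\mid L\}}\,\{1-\mathbb{E}[A^{(a)}\mid Z,L]\}+\mathbb{E}[A^{(a)}Y\mid Z,L].$$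
   Context: $A\in\mathcal{A}=\{0,\dots,M\}$ is a treatment, $Z\in\mathcal{Z}\subseteq\mathbb{R}^{d_Z}$ an instrument (multi-categorical or continuous), $L\in\mathcal{L}\subseteq\mathbb{R}^{d_L}$ observed covariates, $Y\in\mathbb{R}$ an outcome. A function $\pi(Z,L)$ is a regular weighting function for $A=a$ if it is uniformly bounded and there exists $\epsilon_0>0$ such that $|\mathrm{Cov}\{I\{A=a\},\pi(Z,L)\mid L\}|\ge\epsilon_0$ uniformly for all $L$. Equalities between random variables are understood almost surely and the (conditional) moments involved are assumed to exist. *)

(* Defs.v *)
(* MathComp-Analysis world. *)
From HB Require Import structures.
From mathcomp Require Import all_boot all_order all_algebra.
From mathcomp Require Import all_classical all_reals all_analysis.

Set Implicit Arguments.
Unset Strict Implicit.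
Unset Printing Implicit Defensive.

Import Order.TTheory GRing.Theory Num.Theory.
Import numFieldNormedType.Exports.

Local Open Scope classical_set_scope.
Local Open Scope ring_scope.

Section conditional_moments.
Context d d' (T : measurableType d) (T' : measurableType d') (R : realType).
Variables (P : probability T R) (V : T -> T').

(* [g] is a version of the regression function [v |-> E[X | V = v]]; the
   random variable [E[X | V]] is then [g \o V].  By the Radon-Nikodym theorem
   a version exists as soon as [X] is integrable, and any two versions agree
   almost everywhere for the law of [V]. *)
Definition is_cond_exp (X : T -> R) (g : T' -> R) : Prop :=
  [/\ P.-integrable setT (EFin \o X),
      measurable_fun setT g,
      P.-integrable setT (EFin \o (g \o V)) &
      forall B : set T', measurable B ->
        (\int[P]_(w in V @^-1` B) (X w)%:E =
         \int[P]_(w in V @^-1` B) (g (V w))%:E)%E].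

(* [c] is a version of
   [Cov(X, W | V) = E[(X - E[X | V]) (W - E[W | V]) | V]]. *)
Definition is_cond_cov (X W : T -> R) (c : T' -> R) : Prop :=
  exists mX mW : T' -> R,
    [/\ is_cond_exp X mX, is_cond_exp W mW &
        is_cond_exp (fun w => (X w - mX (V w)) * (W w - mW (V w))) c].

End conditional_moments.

Section instrumental_variable.
Context d (T : measurableType d) (R : realType) (P : probability T R).
Variables (M dZ dL : nat).
Variables (A : T -> 'I_M.+1) (Y : T -> R).
Variables (Z : {RV P >-> dZ.-tuple R}) (L : {RV P >-> dL.-tuple R}).
Variables (calZ : set (dZ.-tuple R)) (calL : set (dL.-tuple R)).

Definition ZL (w : T) : dZ.-tuple R * dL.-tuple R := (Z w, L w).

(* The indicator A^(a) of the event [A = a], as a real random variable. *)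
Definition ind (a : 'I_M.+1) (w : T) : R := (A w == a)%:R.

(* [(z, l) |-> Pr(A = a | Z = z, L = l)] is only determined up to a null set
   of the law of (Z, L): a single version could be made non-constant in [z] by
   changing it on a null set even when A^(a) and [Z] are conditionally
   independent given [L].  Dependence therefore means that no version avoids
   taking two distinct values in [z], for almost all [l]. *)
Definition iv_relevance : Prop :=
  forall (a : 'I_M.+1) (p : dZ.-tuple R * dL.-tuple R -> R),
    is_cond_exp P ZL (ind a) p ->
    {ae distribution P L, forall l, calL l ->
      exists z0 z1, [/\ calZ z0, calZ z1, z0 <> z1 & p (z0, l) <> p (z1, l)]}.

Definition regular_weight (a : 'I_M.+1)
    (pi : dZ.-tuple R * dL.-tuple R -> R) : Prop :=
  [/\ measurable_fun setT pi,
      (exists C : R, forall z l, calZ z -> calL l -> `|pi (z, l)| <= C) &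
      exists2 e0 : R, 0 < e0 &
        exists2 c, is_cond_cov P L (ind a) (pi \o ZL) c &
          {ae P, forall w, e0 <= `|c (L w)|}].

(* [f false] and [f true] stand for f(0, .) and f(1, .).  The equality
   E[A^(a) Y | Z, L] = E[f(A^(a), L) | Z, L] is expressed by a common version
   of both sides. *)
Definition solves (a : 'I_M.+1) (f : bool -> dL.-tuple R -> R) : Prop :=
  (forall b, measurable_fun setT (f b)) /\
  exists m, is_cond_exp P ZL (fun w => ind a w * Y w) m /\
            is_cond_exp P ZL (fun w => f (A w == a) (L w)) m.

End instrumental_variable.

(* Main.v *)
(* Writing f(A^(a), L) = F0(L) + F1(L) A^(a), the equation says that
   A^(a) Y - F0(L) - F1(L) A^(a) has conditional expectation 0 given (Z, L), so
   E[A^(a) Y | Z, L] = F0(L) + F1(L) E[A^(a) | Z, L].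

   For two solutions the differences satisfy 0 = G0(L) + G1(L) E[A^(a) | Z, L].
   Where G1(l) <> 0 the regression of A^(a) on (Z, L) thus has the version
   - G0(l) / G1(l), constant in z, which relevance forbids; hence G1 = 0, and
   then G0 = 0.

   For a bounded weight W = pi(Z, L), multiplying by W - E[W | L] and
   conditioning on L gives Cov(A^(a) Y, W | L) = F1(L) Cov(A^(a), W | L), which
   determines F1, and F0 follows.

   None of F0(L), F1(L), E[A^(a) Y | L], ... is known to be bounded, so all
   products are formed after truncation to the event that these functions of
   the conditioning variable are at most n. *)
Require Import Defs.
From HB Require Import structures.
From mathcomp Require Import all_boot all_order all_algebra.
From mathcomp Require Import all_classical all_reals all_analysis.
From mathcomp Require Import measurable_realfun ring lra.

Import Order.TTheory GRing.Theory Num.Theory.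
Import numFieldNormedType.Exports.

Local Open Scope classical_set_scope.
Local Open Scope ring_scope.

Set Implicit Arguments.
Unset Strict Implicit.

Import HBNNSimple.

(** Writing [x^-1] as [x * (x^2)^-1] leaves the power [-1] of a nonnegative number; at [x = 0] both
    sides are [0], as inverses of zero are zero. *)
Lemma measurable_funV d (T : measurableType d) (R : realType) (f : T -> R) :
  measurable_fun setT f -> measurable_fun setT (fun x => (f x)^-1).
Proof.
move=> mf; rewrite (_ : (fun _ => _) = fun x => f x * (f x ^+ 2) `^ (-1)).
  apply: measurable_funM => //.
  apply: (measurableT_comp (measurable_powR (-1))).
  exact: measurable_funX.
apply/funext => x; rewrite powR_inv1 ?sqr_ge0//.
by have [->|f0] := eqVneq (f x) 0; [rewrite invr0 mul0r|field].
Qed.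

(** * Random variables with zero conditional expectation *)

Section centered.
Context d d' (T : measurableType d) (T' : measurableType d') (R : realType).
Variables (P : probability T R) (V : T -> T').
Hypothesis mV : measurable_fun setT V.
Implicit Types D : T -> R.

(* [E[D | V] = 0]. *)
Definition centered D : Prop :=
  P.-integrable setT (EFin \o D) /\
  forall B : set T', measurable B -> (\int[P]_(w in V @^-1` B) (D w)%:E = 0)%E.

Lemma measurable_preimage (B : set T') : measurable B -> measurable (V @^-1` B).
Proof. by move=> mB; rewrite -[X in measurable X]setTI; exact: mV. Qed.

Lemma centered_measurable D : centered D -> measurable_fun setT D.
Proof. by case=> /measurable_int/measurable_EFinP. Qed.

Lemma centeredD D1 D2 : centered D1 -> centered D2 ->
  centered (fun w => D1 w + D2 w).
Proof.
move=> [i1 c1] [i2 c2]; split.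
  exact: (integrableD measurableT i1 i2).
move=> B mB; have mVB := measurable_preimage mB.
have := @integralD_EFin _ _ _ P _ mVB D1 D2.
rewrite /= c1// c2// adde0; apply; exact: (integrableS measurableT).
Qed.

Lemma centeredZ r D : centered D -> centered (fun w => r * D w).
Proof.
move=> [i c]; split.
  by have := integrableZl measurableT r i.
move=> B mB; have mVB := measurable_preimage mB.
under eq_integral do rewrite EFinM.
rewrite integralZl ?c ?mule0//; exact: (integrableS measurableT _ _ i).
Qed.

Lemma centered0 : centered (fun=> 0).
Proof. by split=> [|B mB]; [exact: integrable0|rewrite integral0]. Qed.

Lemma centeredB D1 D2 : centered D1 -> centered D2 ->
  centered (fun w => D1 w - D2 w).
Proof.
move=> c1 /(centeredZ (-1)) /(centeredD c1).
by congr centered; apply/funext => w; rewrite mulN1r.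
Qed.

Lemma ae_eq_centered D1 D2 : measurable_fun setT D2 ->
  {ae P, forall w, D1 w = D2 w} -> centered D1 -> centered D2.
Proof.
move=> m2 e c1; have m1 := centered_measurable c1; case: c1 => i1 c1.
have e' (S : set T) : ae_eq P S (EFin \o D1) (EFin \o D2).
  by apply: filterS e => w /= ->.
split.
  apply/integrableP; split; first exact/measurable_EFinP.
  have /integrableP[_] := i1; congr (_ < _)%E.
  apply: ae_eq_integral => //.
  - by do 2 apply: measurableT_comp => //.
  - by do 2 apply: measurableT_comp => //.
  - by apply: filterS e => w /= ->.
move=> B mB; rewrite -(c1 B mB); apply/esym/ae_eq_integral => //.
- exact: measurable_preimage.
- by apply/measurable_EFinP; exact: measurable_funTS.
- by apply/measurable_EFinP; exact: measurable_funTS.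
Qed.

Lemma centered_sum (I : Type) (s : seq I) (D : I -> T -> R) :
  (forall i, centered (D i)) -> centered (fun w => \sum_(i <- s) D i w).
Proof.
move=> c; elim: s => [|i s ih].
  by under eq_fun do rewrite big_nil; exact: centered0.
by under eq_fun do rewrite big_cons; exact: centeredD.
Qed.

Lemma centered_indic D (E : set T') : measurable E -> centered D ->
  centered (fun w => \1_E (V w) * D w).
Proof.
move=> mE [i c].
have eD : (fun w => (\1_E (V w) * D w)%:E) = (EFin \o D) \_ (V @^-1` E).
  apply/funext => w; rewrite patchE indicE -[w \in _]/(V w \in E) /=.
  by case: ifPn => _; rewrite ?mul1r ?mul0r.
split.
  rewrite /comp eD; apply/(integrable_mkcond _ (measurable_preimage mE)).
  by apply: (integrableS measurableT _ _ i) => //; exact: measurable_preimage.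
move=> B mB; rewrite eD -integral_mkcondr -preimage_setI c//.
exact: measurableI.
Qed.

(** Indicators of events of [V] and their linear combinations preserve centering. The general case
    follows by approximating [h] from below by simple functions, with [|h(V) D|] as the dominating
    function. *)
Lemma centeredM_ge0 D (h : T' -> R) : measurable_fun setT h ->
  (forall v, 0 <= h v) -> P.-integrable setT (EFin \o (fun w => h (V w) * D w)) ->
  centered D -> centered (fun w => h (V w) * D w).
Proof.
move=> mh h0 ihD cD; split=> // B mB.
have mVB := measurable_preimage mB.
have mh' : measurable_fun setT (EFin \o h) by exact/measurable_EFinP.
pose h_ n := nnsfun_approx measurableT mh' n.
have ch_ n : centered (fun w => h_ n (V w) * D w).
  under eq_fun do rewrite fimfunEord mulr_suml.
  apply: centered_sum => i.
  under eq_fun do rewrite -mulrA.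
  apply/centeredZ/centered_indic => //.
have h_cvg v : h_ ^~ v @ \oo --> h v.
  have := @cvg_nnsfun_approx _ _ _ _ measurableT _ mh' (fun x _ => h0 x) v I.
  by move=> /fine_cvgP[_].
have h_le n v : `|h_ n v| <= h v.
  rewrite ger0_norm// -(cvg_lim _ (h_cvg v))//.
  apply: (@nondecreasing_cvgn_le _ (h_ ^~ v)).
    by move=> m p mp; exact/lefP/nd_nnsfun_approx.
  by apply/cvg_ex; exists (h v); exact: h_cvg.
have ihD' := integrableS measurableT mVB (@subsetT _ _) ihD.
have [|||||_ _ cv] := @dominated_convergence _ _ _ P _ mVB
  (fun n w => (h_ n (V w) * D w)%:E) (fun w => (h (V w) * D w)%:E)
  (fun w => `|h (V w) * D w|%:E).
- move=> n; apply: measurable_funTS.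
  by apply/measurable_EFinP/centered_measurable.
- by apply: measurable_int ihD'.
- apply: aeW => w _; apply: cvg_EFin; first exact: nearW.
  by apply: cvgM; [exact: h_cvg|exact: cvg_cst].
- exact: integrable_norm.
- apply: aeW => w n _.
  by rewrite lee_fin !normrM ler_wpM2r// (ger0_norm (h0 _)).
- rewrite -(cvg_lim _ cv)//.
  rewrite (_ : [sequence _]_n = cst 0%E) ?lim_cst//.
  by apply/funext => n; exact: (ch_ n).2.
Qed.

(** The positive and negative parts of [h] both lie between [0] and [|h|], so each product inherits
    integrability from [h(V) D]. *)
Lemma centeredM D (h : T' -> R) : measurable_fun setT h ->
  P.-integrable setT (EFin \o (fun w => h (V w) * D w)) ->
  centered D -> centered (fun w => h (V w) * D w).
Proof.
move=> mh ihD cD.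
have mVh (g : T' -> R) : measurable_fun setT g ->
    measurable_fun setT (fun w => g (V w) * D w).
  move=> mg; apply: measurable_funM; last exact: centered_measurable.
  exact: measurableT_comp.
have part (g : T' -> R) : measurable_fun setT g ->
    (forall v, 0 <= g v <= `|h v|) -> centered (fun w => g (V w) * D w).
  move=> mg gh; apply: centeredM_ge0 => //.
    by move=> v; have /andP[] := gh v.
  apply: le_integrable ihD => //; first exact/measurable_EFinP/mVh.
  move=> w _ /=; rewrite lee_fin !normrM ler_wpM2r//.
  by have /andP[? ?] := gh (V w); rewrite ger0_norm.
have -> : (fun w => h (V w) * D w) =
    (fun w => h^\+ (V w) * D w - h^\- (V w) * D w).
  by apply/funext => w; rewrite -mulrBl -[in LHS](funrposBneg h).
have hpm v : h^\+ v + h^\- v = `|h v|.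
  by rewrite -[RHS]/((Num.norm \o h) v) -funrposDneg.
apply: centeredB; apply: part.
- exact: measurable_funrpos.
- by move=> v; rewrite -hpm funrpos_ge0/= lerDl funrneg_ge0.
- exact: measurable_funrneg.
- by move=> v; rewrite -hpm funrneg_ge0/= lerDr funrpos_ge0.
Qed.

Lemma centeredM_bounded D (h : T' -> R) (C : R) : measurable_fun setT h ->
  (forall w, `|h (V w)| <= C) ->
  centered D -> centered (fun w => h (V w) * D w).
Proof.
move=> mh hC cD; apply: centeredM => //.
have [iCD _] := centeredZ C cD.
apply: le_integrable iCD => //.
  apply/measurable_EFinP/measurable_funM; last exact: centered_measurable.
  exact: measurableT_comp.
move=> w _ /=; rewrite lee_fin !normrM ler_wpM2r//.
by rewrite (le_trans (hC w))// ler_norm.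
Qed.

(** Multiplying by the sign of [k], a bounded function of [V], turns centering into
    [E|k(V)| = 0]. *)
Lemma centered_comp_eq0 (k : T' -> R) : measurable_fun setT k ->
  centered (k \o V) -> {ae P, forall w, k (V w) = 0}.
Proof.
move=> mk ck.
pose s v : R := if 0 <= k v then 1 else -1.
have ms : measurable_fun setT s.
  apply: measurable_fun_ifT => //.
  exact: measurable_fun_ler.
have sk v : s v * k v = `|k v|.
  by rewrite /s; case: (ger0P (k v)) => _; rewrite ?mul1r ?mulN1r.
have := @centeredM_bounded _ s 1 ms _ ck.
have mkV : measurable_fun setT (k \o V) by exact: measurableT_comp.
case=> [w|_ /(_ _ measurableT)].
  by rewrite /s; case: ifP => _; rewrite ?normrN normr1.
rewrite preimage_setT => k0.
have /ae_eq_integral_abs : (\int[P]_w `| (EFin \o (k \o V)) w| = 0)%E.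
  by rewrite -k0; apply: eq_integral => w _ /=; rewrite sk.
move=> /(_ measurableT) ae0.
have : ae_eq P setT (EFin \o (k \o V)) (cst 0%E).
  by apply: ae0; exact/measurable_EFinP.
by apply: filterS => w /(_ I)[].
Qed.


(** * Truncation to sublevel sets of a function of [V] *)

Lemma ae_eq0_truncated (s : T' -> R) (k : T -> R) :
  (forall n : nat, {ae P, forall w, \1_[set v | s v <= n%:R] (V w) * k w = 0}) ->
  {ae P, forall w, k w = 0}.
Proof.
(* Every point lies in the sublevel set of some integer, here one more than the integer part of
   [s (V w)]. *)
move=> /ae_foralln; apply: filterS => w /(_ (Num.truncn (s (V w))).+1).
by rewrite indicE mem_set ?mul1r//= ltW// truncnS_gt.
Qed.

Lemma measurable_truncation (s : T' -> R) (r : R) : measurable_fun setT s ->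
  measurable_fun setT (\1_[set v | s v <= r] : T' -> R).
Proof.
move=> ms; apply: measurable_indic.
rewrite -[X in measurable X]setTI.
exact: (measurable_fun_le measurableT ms (measurable_cst r)).
Qed.

(** On the sublevel set [|u| <= s <= r], and off it the product is [0]; taking [|r|] as the bound
    covers negative [r] as well. *)
Lemma normM_truncation (s u : T' -> R) (r : R) v :
  `|u v| <= s v -> `|\1_[set v | s v <= r] v * u v| <= `|r|.
Proof.
move=> us; rewrite indicE.
case: (boolP (v \in _)) => [|_]; last by rewrite mul0r normr0.
by rewrite inE/= mul1r => sr; rewrite (le_trans us)// (le_trans sr)// ler_norm.
Qed.

(** * Conditional expectations and covariances: uniqueness and existence *)

Lemma centered_cond_exp X g : is_cond_exp P V X g ->
  centered (fun w => X w - g (V w)).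
Proof.
move=> [iX mg ig e]; split; first exact: (integrableB measurableT iX ig).
move=> B mB; have mVB := measurable_preimage mB.
have iXB := integrableS measurableT mVB (@subsetT _ _) iX.
have igB := integrableS measurableT mVB (@subsetT _ _) ig.
have := integralB_EFin mVB iXB igB.
rewrite e//= => ->; rewrite subee//; exact: (integrable_fin_num mVB igB).
Qed.

Lemma ae_eq_cond_exp X g g' : measurable_fun setT g' ->
  {ae P, forall w, g (V w) = g' (V w)} -> is_cond_exp P V X g ->
  is_cond_exp P V X g'.
Proof.
move=> mg' gg' [iX mg ig e].
have mgV : measurable_fun setT (EFin \o (g \o V)) by exact: measurable_int ig.
have mgV' : measurable_fun setT (EFin \o (g' \o V)).
  by apply/measurable_EFinP; exact: measurableT_comp.
have eV B : ae_eq P B (EFin \o (g \o V)) (EFin \o (g' \o V)).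
  by apply: filterS gg' => w /= ->.
split=> //.
  apply/integrableP; split=> //; have /integrableP[_] := ig; congr (_ < _)%E.
  apply: ae_eq_integral => //; [exact: measurableT_comp|exact: measurableT_comp|].
  by apply: filterS gg' => w /= ->.
move=> B mB; rewrite e//; apply: ae_eq_integral => //.
- exact: measurable_preimage.
- exact: measurable_funTS.
- exact: measurable_funTS.
Qed.

(** In the difference of the two residuals [X] cancels, leaving a centered function of [V] alone. *)
Lemma cond_exp_unique X g g' : is_cond_exp P V X g -> is_cond_exp P V X g' ->
  {ae P, forall w, g (V w) = g' (V w)}.
Proof.
move=> cg cg'.
have [_ mg _ _] := cg; have [_ mg' _ _] := cg'.
have := centeredB (centered_cond_exp cg') (centered_cond_exp cg).
rewrite (_ : (fun _ => _) = (fun v => g v - g' v) \o V); last first.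
  by apply/funext => w /=; ring.
move=> /centered_comp_eq0 H; apply: filterS (H _); last exact: measurable_funB.
by move=> w /subr0_eq.
Qed.

Lemma cond_cov_unique X W c c' : is_cond_cov P V X W c ->
  is_cond_cov P V X W c' -> {ae P, forall w, c (V w) = c' (V w)}.
Proof.
move=> [mX [mW [eX eW ec]]] [mX' [mW' [eX' eW' ec']]].
have [_ mc _ _] := ec; have [_ mc' _ _] := ec'.
have cc := centeredB (centered_cond_exp ec') (centered_cond_exp ec).
suff : {ae P, forall w, c (V w) - c' (V w) = 0}.
  by apply: filterS => w /subr0_eq.
apply: (centered_comp_eq0 (k := fun v => c v - c' v)).
  exact: measurable_funB.
(* The two covariances may use different versions of the conditional means, so the products of
   deviations cancel only almost everywhere. *)
apply: ae_eq_centered cc.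
  by apply: measurableT_comp => //; exact: measurable_funB.
apply: filterS2 (cond_exp_unique eX eX') (cond_exp_unique eW eW') => w /= -> ->.
by ring.
Qed.

(** The version is the Radon-Nikodym derivative, with respect to the law of [V], of the image under
    [V] of the charge with density [X]. *)
Lemma cond_exp_exists X : P.-integrable setT (EFin \o X) ->
  exists g, is_cond_exp P V X g.
Proof.
move=> iX.
pose VP : {mfun T >-> T'} :=
  HB.pack_for {mfun T >-> T'} V (isMeasurableFun.Build _ _ _ _ _ mV).
pose mu := distribution P VP.
(* The instance has to be named: it depends on [mV], which unification cannot
   find. *)
pose nu := measure_function_pushforward__canonical__charge_Charge
  (induced_charge iX) mV.
have numu : nu `<< mu.
  apply/null_content_dominatesP => B mB muB0.
  apply: null_set_integral => //; first exact: measurable_preimage.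
  by apply: measurable_funTS; exact: measurable_int iX.
have [g [gfin ig gE]] : exists g : T' -> \bar R,
    [/\ (forall v, g v \is a fin_num),
    mu.-integrable setT g &
    forall B, measurable B -> nu B = (\int[mu]_(v in B) g v)%E].
  exists (Radon_Nikodym nu mu); split.
  - by move=> v; exact: Radon_Nikodym_fin_num.
  - exact: Radon_Nikodym_integrable.
  - by move=> B mB; exact: Radon_Nikodym_integral.
have mg : measurable_fun setT g by exact: measurable_int ig.
have igV : P.-integrable setT (g \o V).
  apply/integrableP; split; first exact: measurableT_comp.
  have /integrableP[_] := ig; congr (_ < _)%E.
  rewrite ge0_integral_pushforward//.
  exact: measurableT_comp.
(* The derivative is finite everywhere, so passing to real values with [fine] loses nothing. *)
have gV : EFin \o (fine \o g \o V) = g \o V.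
  by apply/funext => w /=; rewrite fineK.
exists (fine \o g); split=> //; [exact: measurableT_comp|by rewrite gV|].
move=> B mB; rewrite -[RHS]/(\int[P]_(w in _) (EFin \o (fine \o g \o V)) w)%E gV.
rewrite -(@integral_pushforward _ _ _ _ _ V mV P B g)//.
  by rewrite -gE.
exact: (integrableS measurableT (measurable_preimage mB) (@subsetT _ _) igV).
Qed.

End centered.

(** * Responses whose conditional mean given [V] is affine in [A], with coefficients depending on
    [L = phi(V)] *)

Section affine_response.
Context d d' d'' (T : measurableType d) (T' : measurableType d')
  (T'' : measurableType d'') (R : realType).
Variables (P : probability T R) (V : T -> T') (phi : T' -> T'').
Hypotheses (mV : measurable_fun setT V) (mphi : measurable_fun setT phi).
Let L := phi \o V.

Let mL : measurable_fun setT L. Proof. exact: measurableT_comp. Qed.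

(** Tower property: every event of [L] is an event of [V]. *)
Lemma centered_tower (D : T -> R) : centered P V D -> centered P L D.
Proof.
move=> [i c]; split=> // B mB; rewrite comp_preimage c//.
exact: measurable_preimage.
Qed.

Variables (X A : T -> R) (F0 F1 : T'' -> R).
Hypotheses (mF0 : measurable_fun setT F0) (mF1 : measurable_fun setT F1).
Hypothesis XF : centered P V (fun w => X w - (F0 (L w) + F1 (L w) * A w)).

(** In [(X - F0 - F1 A) + F1 (A - p) - (X - m)] both [X] and [A] cancel, which leaves a function of
    [V]; truncated, each term is centered. *)
Lemma cond_exp_affine (p m : T' -> R) :
  measurable_fun setT p -> measurable_fun setT m ->
  centered P V (fun w => A w - p (V w)) ->
  centered P V (fun w => X w - m (V w)) ->
  {ae P, forall w, m (V w) = F0 (L w) + F1 (L w) * p (V w)}.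
Proof.
move=> mp mm cp cm.
suff : {ae P, forall w, m (V w) - (F0 (L w) + F1 (L w) * p (V w)) = 0}.
  by apply: filterS => w /subr0_eq.
(* [F1] is the only possibly unbounded factor of a centered variable, so it alone is truncated. *)
pose s v := `|F1 (phi v)|.
have mF0p : measurable_fun setT (F0 \o phi) by exact: measurableT_comp.
have mF1p : measurable_fun setT (F1 \o phi) by exact: measurableT_comp.
have ms : measurable_fun setT s by exact: measurableT_comp.
apply: (ae_eq0_truncated (V := V) (s := s)) => n.
pose h : T' -> R := \1_[set v | s v <= n%:R].
have mh : measurable_fun setT h by exact: measurable_truncation.
have h1 w : `|h (V w)| <= 1.
  by rewrite /h indicE; case: (_ \in _); rewrite ?normr1 ?normr0.
have mhF1 : measurable_fun setT (fun v => h v * F1 (phi v)).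
  exact: measurable_funM.
have hF1 w : `|h (V w) * F1 (phi (V w))| <= `|n%:R|.
  exact: (normM_truncation (u := F1 \o phi)).
have c1 := centeredM_bounded mV mh h1 XF.
have c2 := centeredM_bounded mV mhF1 hF1 cp.
have c3 := centeredM_bounded mV mh h1 cm.
have := centeredB mV (centeredD mV c1 c2) c3.
pose k v := h v * (m v - (F0 (phi v) + F1 (phi v) * p v)).
have mk : measurable_fun setT k.
  apply: measurable_funM => //; apply: measurable_funB => //.
  by apply: measurable_funD => //; exact: measurable_funM.
rewrite (_ : (fun w => _) = k \o V); first exact: centered_comp_eq0.
by apply/funext => w; rewrite /k /L /=; ring.
Qed.

(** The truncated [F1 cA - cX] is written as a signed sum of variables centered given [L]. The term
    [t3], where the affine residual meets a weight depending on all of [V], is centered given [V]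
    first and then descends to [L]; the others correct for the conditional means. *)
Lemma cond_cov_affine (W : T' -> R) (C : R) (cX cA : T'' -> R) :
  measurable_fun setT W -> (forall w, `|W (V w)| <= C) ->
  is_cond_cov P L X (W \o V) cX -> is_cond_cov P L A (W \o V) cA ->
  {ae P, forall w, cX (L w) = F1 (L w) * cA (L w)}.
Proof.
move=> mW WC [mX [mW1 [eX eW1 ecX]]] [mA [mW2 [eA eW2 ecA]]].
have [[_ mmX _ _] [_ mmW1 _ _] [_ mcX _ _]] := And3 eX eW1 ecX.
have [[_ mmA _ _] [_ mmW2 _ _] [_ mcA _ _]] := And3 eA eW2 ecA.
suff : {ae P, forall w, F1 (L w) * cA (L w) - cX (L w) = 0}.
  by apply: filterS => w /subr0_eq.
(* One sublevel set of this sum bounds by [n] each of the functions of [L] that occur in the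
   multipliers. *)
pose s l := `|F0 l| + `|F1 l| + `|mX l| + `|mA l| + `|mW1 l|.
have ms : measurable_fun setT s.
  by rewrite /s; repeat apply: measurable_funD => //; exact: measurableT_comp.
apply: (ae_eq0_truncated (V := L) (s := s)) => n.
pose h : T'' -> R := \1_[set l | s l <= n%:R].
have mh : measurable_fun setT h by exact: measurable_truncation.
have hs (u : T'' -> R) l : `|u l| <= s l -> `|h l * u l| <= n%:R.
  by move=> /(normM_truncation n%:R); rewrite normr_nat.
have h1 l : `|h l| <= 1.
  by rewrite /h indicE; case: (_ \in _); rewrite ?normr1 ?normr0.
have [F0s F1s mXs mAs mW1s] :
  [/\ forall l, `|F0 l| <= s l, forall l, `|F1 l| <= s l,
      forall l, `|mX l| <= s l, forall l, `|mA l| <= s l &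
      forall l, `|mW1 l| <= s l].
  by split=> l; rewrite /s; have := normr_ge0 (F0 l); have := normr_ge0 (F1 l);
    have := normr_ge0 (mX l); have := normr_ge0 (mA l);
    have := normr_ge0 (mW1 l); lra.
have bounded_h (u : T'' -> R) : measurable_fun setT u ->
    (forall l, `|u l| <= s l) ->
    forall D, centered P L D -> centered P L (fun w => h (L w) * u (L w) * D w).
  move=> mu us D.
  apply: (centeredM_bounded mL (h := fun l => h l * u l) (C := n%:R)).
    exact: measurable_funM.
  by move=> w; exact: hs.
have cX' := centered_cond_exp mL ecX.
have cA' := centered_cond_exp mL ecA.
have cW1 := centered_cond_exp mL eW1.
have cW2 := centered_cond_exp mL eW2.
have t1 := centeredM_bounded mL mh (fun w => h1 (L w)) cX'.
have t2 := bounded_h mX mmX mXs _ cW1.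
have t3 : centered P L (fun w => h (L w) * (W (V w) - mW1 (L w)) *
    (X w - (F0 (L w) + F1 (L w) * A w))).
  apply: centered_tower.
  apply: (centeredM_bounded mV
    (h := fun v => h (phi v) * (W v - mW1 (phi v))) (C := C + n%:R)) => //.
    apply: measurable_funM; first exact: measurableT_comp.
    by apply: measurable_funB => //; exact: measurableT_comp.
  move=> w; rewrite mulrBr (le_trans (ler_normB _ _))// lerD//.
    by rewrite normrM -[leRHS]mul1r ler_pM.
  exact: hs.
have t4 := bounded_h F0 mF0 F0s _ cW1.
have t5 := bounded_h F1 mF1 F1s _ cA'.
(* The indicator occurs twice so that [F1] and [mA] are each bounded by [n]; idempotence of [h]
   removes the duplicate below. *)
have t6 : centered P L (fun w => h (L w) * F1 (L w) * (h (L w) * mA (L w)) *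
    (W (V w) - mW2 (L w))).
  apply: (centeredM_bounded mL
    (h := fun l => h l * F1 l * (h l * mA l)) (C := n%:R * n%:R)) => //.
    by apply: measurable_funM; exact: measurable_funM.
  by move=> w; rewrite normrM ler_pM// hs.
have hh l : h l * h l = h l.
  by rewrite /h indicE; case: (_ \in _); rewrite ?mulr1 ?mulr0.
have := centeredB mL (centeredB mL (centeredB mL (centeredB mL
  (centeredD mL t1 t2) t3) t4) t5) t6.
pose k l := h l * (F1 l * cA l - cX l).
have mk : measurable_fun setT k.
  apply: measurable_funM => //; apply: measurable_funB => //.
  exact: measurable_funM.
move=> cE; apply: (centered_comp_eq0 mL mk).
apply: ae_eq_centered cE => //; first exact: measurableT_comp.
(* The two covariances bring their own versions of [E[W | L]]; the terms cancel once these are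
   identified. *)
apply: filterS (cond_exp_unique mL eW1 eW2) => w /= e12.
rewrite /k /= e12 mulrACA hh.
ring.
Qed.

End affine_response.

(** * Uniqueness of the solution and its covariance formulas *)

Theorem theorem2p1 (d : measure_display) (T : measurableType d) (R : realType)
    (P : probability T R) (M dZ dL : nat)
    (A : T -> 'I_M.+1) (Y : {RV P >-> R})
    (Z : {RV P >-> dZ.-tuple R}) (L : {RV P >-> dL.-tuple R})
    (calZ : set (dZ.-tuple R)) (calL : set (dL.-tuple R))
    (mA : forall a : 'I_M.+1, measurable (A @^-1` [set a]))
    (hZ : forall w : T, calZ (Z w)) (hL : forall w : T, calL (L w))
    (relevance : iv_relevance A Z L calZ calL)
    (a : 'I_M.+1) (f : bool -> dL.-tuple R -> R)
    (hf : solves A Y Z L a f) :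
  (forall f' : bool -> dL.-tuple R -> R, solves A Y Z L a f' ->
     forall b : bool, {ae P, forall w, f' b (L w) = f b (L w)}) /\
  (forall pi : dZ.-tuple R * dL.-tuple R -> R,
     regular_weight A Z L calZ calL a pi ->
     forall (eA eAY : dZ.-tuple R * dL.-tuple R -> R)
            (covA covAY : dL.-tuple R -> R),
       is_cond_exp P (ZL Z L) (ind R A a) eA ->
       is_cond_exp P (ZL Z L) (fun w => ind R A a w * Y w) eAY ->
       is_cond_cov P L (ind R A a) (pi \o ZL Z L) covA ->
       is_cond_cov P L (fun w => ind R A a w * Y w) (pi \o ZL Z L) covAY ->
       {ae P, forall w, f false (L w) =
          - (covAY (L w) / covA (L w)) * eA (Z w, L w) + eAY (Z w, L w)} /\
       {ae P, forall w, f true (L w) =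
          covAY (L w) / covA (L w) * (1 - eA (Z w, L w)) + eAY (Z w, L w)}).
Proof.
have mZ : measurable_fun setT Z by exact: measurable_funP.
have mL : measurable_fun setT L by exact: measurable_funP.
have mZL : measurable_fun setT (ZL Z L) by exact: measurable_fun_pair.
(* Both regressions share the version [m], which cancels; as the indicator is [0] or [1], [g] is
   affine in it. *)
have solves_centered g : solves A Y Z L a g ->
    [/\ measurable_fun setT (g false),
      measurable_fun setT (fun l => g true l - g false l) &
      centered P (ZL Z L) (fun w => ind R A a w * Y w -
        (g false (L w) + (g true (L w) - g false (L w)) * ind R A a w))].
  move=> [mg [m [cY cg]]]; split => //; first exact: measurable_funB.
  have := centeredB mZL (centered_cond_exp mZL cY) (centered_cond_exp mZL cg).
  congr centered; apply/funext => w; rewrite /ind.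
  by case: (A w == a); rewrite /=; ring.
have [mf0 mf1 cf] := solves_centered f hf.
have iA : P.-integrable setT (EFin \o ind R A a).
  rewrite (_ : _ \o _ = EFin \o \1_(A @^-1` [set a])).
    exact: integrable_indic.
  apply/funext => w /=; rewrite indicE /ind; congr ((nat_of_bool _)%:R%:E).
  by apply/idP/idP => [/eqP Aw|/set_mem/= ->]; [exact: mem_set|exact: eqxx].
split=> [f' hf'|pi [mpi [C piC] [e0 e0_gt0 [c covc ce0]]] eA eAY covA covAY
  cA cAY ccovA ccovAY].
  have [mf0' mf1' cf'] := solves_centered f' hf'.
  have [p cp] := cond_exp_exists mZL iA.
  have [_ mp _ _] := cp.
  pose G0 l := f false l - f' false l.
  pose G1 l := (f true l - f false l) - (f' true l - f' false l).
  have mG0 : measurable_fun setT G0 by exact: measurable_funB.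
  have mG1 : measurable_fun setT G1 by exact: measurable_funB.
  (* The difference of two solutions is an affine relation with response [0], whose conditional mean
     has the version [0]. *)
  have cG : centered P (ZL Z L)
      (fun w => 0 - (G0 (L w) + G1 (L w) * ind R A a w)).
    have := centeredB mZL cf cf'.
    by congr centered; apply/funext => w; rewrite /G0 /G1; ring.
  have c0 : centered P (ZL Z L) (fun w => 0 - (0 : R)).
    by rewrite subr0; exact: centered0.
  have G0G1 := cond_exp_affine mZL measurable_snd mG0 mG1 cG mp
    (measurable_cst (0 : R)) (centered_cond_exp mZL cp) c0.
  have mq : measurable_fun setT (fun l => - G0 l / G1 l).
    by apply: measurable_funM; [exact: measurable_funN|exact: measurable_funV].
  (* Only where the slope difference is nonzero is [p] replaced, by a quotient free of [z]; the
     result agrees with [p] almost surely and is again a version. *)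
  pose p' zl := if G1 zl.2 == 0 then p zl else - G0 zl.2 / G1 zl.2.
  have cp' : is_cond_exp P (ZL Z L) (ind R A a) p'.
    apply: ae_eq_cond_exp cp => //.
      apply: measurable_fun_ifT => //; last first.
        exact: (measurableT_comp mq measurable_snd).
      apply: measurable_fun_eqr => //.
      exact: (measurableT_comp mG1 measurable_snd).
    apply: filterS G0G1 => w /= /esym e; rewrite /p'; case: eqVneq => // G1n0.
    by apply: (mulfI G1n0); rewrite [RHS]mulrC divfK//; exact/esym/addr0_eq.
  have G10 : {ae P, forall w, G1 (L w) = 0}.
    (* Wherever [G1 l] is nonzero, [p'] is constant in [z], so relevance places [l] in the null set
       [N] of the law of [L]. *)
    have [N [mN PN0 sN]] := relevance a p' cp'.
    exists (L @^-1` N); split=> //.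
      by rewrite -[X in measurable X]setTI; exact: mL.
    move=> w G1w; apply: sN => /= /(_ (hL w)) [z0 [z1 [_ _ _]]].
    by rewrite /p' /=; case: eqVneq.
  have ff' : {ae P, forall w, f' false (L w) = f false (L w) /\
      f' true (L w) = f true (L w)}.
    apply: filterS2 G0G1 G10 => w /= G01 G1w.
    move: G01; rewrite G1w mul0r addr0 => G0w; move: G1w G0w; rewrite /G0 /G1.
    by split; lra.
  by case; apply: filterS ff' => w [].
have [_ meA _ _] := cA; have [_ meAY _ _] := cAY.
have eAYE := cond_exp_affine mZL measurable_snd mf0 mf1 cf meA meAY
  (centered_cond_exp mZL cA) (centered_cond_exp mZL cAY).
have covE := cond_cov_affine mZL measurable_snd mf0 mf1 cf mpi
  (fun w => piC _ _ (hZ w) (hL w)) ccovAY ccovA.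
(* The lower bound [e0] is known for the version [c]; uniqueness carries it over to [covA], which
   makes the division legitimate almost surely. *)
have covAc := cond_cov_unique mL ccovA covc.
have slope : {ae P, forall w,
    covAY (L w) / covA (L w) = f true (L w) - f false (L w)}.
  apply: filterS3 covE covAc ce0 => w /= -> -> ce.
  rewrite mulfK// -normr_gt0; exact: lt_le_trans ce.
by split; apply: filterS2 eAYE slope => w /= -> ->; ring.
Qed.
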